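(* For any nonempty set $P$ of primes, the monoid \[ M_P := \sum_{p\in P} \mathbb{N}_0\big[\tfrac1p\big]\subseteq \mathbb{Q}_{\ge 0} \] (the additive submonoid of $\mathbb{Q}_{\ge 0}$ consisting of all finite sums of elements of $\bigcup_{p\in P}\mathbb{N}_0[\frac1p]$) is an MCD monoid.
   Context: For a prime $p$, $\mathbb{N}_0[\frac1p]=\{a/p^n : a,n\in\mathbb{N}_0\}$ is the additive monoid of nonnegative $p$-adic rationals. For an additive submonoid $M$ of $\mathbb{Q}_{\ge 0}$ and $a,b\in M$, write $b\mid_M a$ ($b$ divides $a$) if $a-b\in M$. For a nonempty finite subset $S$ of $M$, a common divisor $d\in M$ of $S$ (i.e. $d\mid_M s$ for all $s\in S$) is a maximal common divisor (MCD) of $S$ if the only common divisor of $\{s-d : s\in S\}$ in $M$ is $0$ (the only unit of $M$). $M$ is an MCD monoid if every nonempty finite subset of $M$ has an MCD. *)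

(* Defs.v *)
From mathcomp Require Import all_boot all_order all_algebra.
From mathcomp Require Import all_classical.

Set Implicit Arguments.
Unset Strict Implicit.
Unset Printing Implicit Defensive.

Import Order.TTheory GRing.Theory Num.Theory.

Local Open Scope ring_scope.
Local Open Scope classical_set_scope.

Definition additive_submonoid (M : set rat) : Prop :=
  [/\ M `<=` [set x | 0 <= x], M 0 & forall x y, M x -> M y -> M (x + y)].

Definition divides (M : set rat) (b a : rat) : Prop :=
  [/\ M b, M a & M (a - b)].

Definition common_divisors (M S : set rat) : set rat :=
  [set d | M d /\ forall s, S s -> divides M d s].

Definition is_MCD (M S : set rat) (d : rat) : Prop :=
  common_divisors M S d /\ common_divisors M [set s - d | s in S] = [set 0].

Definition MCD_monoid (M : set rat) : Prop :=
  additive_submonoid M /\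
  forall S : set rat, S `<=` M -> finite_set S -> S !=set0 ->
    exists d : rat, is_MCD M S d.

Definition nonneg_padic_rationals (p : nat) : set rat :=
  [set x | exists a n : nat, x = a%:R / p%:R ^+ n].

Definition finite_sums (A : set rat) : set rat :=
  [set x | exists2 s : seq rat, {in s, forall y, A y} & x = \sum_(y <- s) y].

Definition MP (P : set nat) : set rat :=
  finite_sums (\bigcup_(p in P) nonneg_padic_rationals p).

(* Main.v *)
(**
By partial fractions, a rational [x] is the sum of its [p]-fractional parts
[0 <= ppart p x < 1] (with [p]-power denominator) and of an integer [ipart x];
[x] lies in [M_P] iff its denominator involves only primes of [P] and
[0 <= ipart x].  Moreover [ipart] is superadditive, and
[ipart (x + y) = ipart x + ipart y] forces [ppart p] to be additive on [x], [y]
for every [p].  Take a common divisor [d] of [S] minimizing the sum of the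
[ipart (s - d)], then add to [d] the sum over [p] of the smallest
[ppart p (s - d)].  This leaves every [ipart (s - d)] unchanged, so a further
common divisor [e] has [ipart e = 0] and, for each [p], its [ppart] is at most
that of some [s - d] whose [ppart] vanishes; hence [e = 0].
*)
Require Import Defs.
From mathcomp Require Import all_boot all_order all_algebra.
From mathcomp Require Import all_classical.
From mathcomp Require Import ring lra.

Local Open Scope classical_set_scope.

Import Order.TTheory GRing.Theory Num.Theory.
Local Open Scope ring_scope.

(** * Local conditions: for [p] prime, [pintegral p] is the localization of the integers at [p], and
    [ppower_denom p] is the ring Z[1/p] *)

Definition pintegral (p : nat) (x : rat) : Prop :=
  exists2 m : nat, coprime p m & x * m%:R \is a Num.int.

Definition ppower_denom (p : nat) (x : rat) : Prop :=
  exists k : nat, x * p%:R ^+ k \is a Num.int.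

(** The strict bound is what arises when a fractional part below 1 is subtracted from a nonnegative
    quantity. *)
Lemma int_gtN1_ge0 (x : rat) : x \is a Num.int -> -1 < x -> 0 <= x.
Proof.
move=> /intrP[m ->]; rewrite -[-1]/((-1)%:~R) ltr_int ler0z.
by case: m.
Qed.

Lemma pintegral_int p x : x \is a Num.int -> pintegral p x.
Proof. by move=> xi; exists 1%N; rewrite ?coprimen1 // mulr1. Qed.

Lemma pintegralD p x y : pintegral p x -> pintegral p y -> pintegral p (x + y).
Proof.
move=> [m pm xm] [n pn yn]; exists (m * n)%N; first by rewrite coprimeMr pm.
rewrite natrM mulrDl [y * _]mulrCA mulrA.
by rewrite rpredD // rpredM // natr_int.
Qed.

Lemma pintegralN p x : pintegral p x -> pintegral p (- x).
Proof. by case=> m pm xm; exists m; rewrite // mulNr rpredN. Qed.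

Lemma pintegralB p x y : pintegral p x -> pintegral p y -> pintegral p (x - y).
Proof. by move=> hx hy; apply/pintegralD/pintegralN. Qed.

Lemma pintegral_sum p (I : Type) (r : seq I) (Q : pred I) (f : I -> rat) :
  (forall i, Q i -> pintegral p (f i)) -> pintegral p (\sum_(i <- r | Q i) f i).
Proof.
move=> hf; apply: (big_ind (pintegral p)) => //; last exact: pintegralD.
exact: pintegral_int.
Qed.

Lemma ppower_denomD p x y :
  ppower_denom p x -> ppower_denom p y -> ppower_denom p (x + y).
Proof.
move=> [m xm] [n yn]; exists (m + n)%N.
rewrite exprD mulrDl [y * _]mulrCA mulrA.
by rewrite rpredD // rpredM // rpredX // natr_int.
Qed.

Lemma ppower_denomN p x : ppower_denom p x -> ppower_denom p (- x).
Proof. by case=> m xm; exists m; rewrite mulNr rpredN. Qed.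

Lemma ppower_denomB p x y :
  ppower_denom p x -> ppower_denom p y -> ppower_denom p (x - y).
Proof. by move=> hx hy; apply/ppower_denomD/ppower_denomN. Qed.

Lemma ppower_denom_int p x : x \is a Num.int -> ppower_denom p x.
Proof. by move=> xi; exists 0%N; rewrite expr0 mulr1. Qed.

Lemma ppower_denom_pintegral p q x :
  prime p -> prime q -> q != p -> ppower_denom p x -> pintegral q x.
Proof.
move=> pp pq qp [k xk]; exists (p ^ k)%N; last by rewrite natrX.
by apply: coprimeXr; rewrite prime_coprime // dvdn_prime2.
Qed.

(** Bezout for the coprime multipliers [m] and [p ^ k] writes [x] as an integer combination of two
    integers. *)
Lemma pintegral_ppower_int p x :
  prime p -> pintegral p x -> ppower_denom p x -> x \is a Num.int.
Proof.
move=> pp [m pm xm] [k xk].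
have /coprimezP[[u v] /= uv] : coprimez m%:Z (p ^ k)%N%:Z.
  by rewrite coprimezE /= coprime_sym coprimeXl.
have -> : x = u%:~R * (x * m%:R) + v%:~R * (x * p%:R ^+ k).
  rewrite -[LHS]mulr1 -[X in x * X]/(1%:~R) -uv rmorphD !rmorphM /=.
  by rewrite -!pmulrn natrX; ring.
by rewrite rpredD // rpredM // intr_int.
Qed.

(** If the denominator exceeded 1, it would divide the multiplier [m] attached to its smallest prime
    factor [p], although [p] is coprime to [m]. *)
Lemma pintegral_all_int x :
  (forall p, prime p -> pintegral p x) -> x \is a Num.int.
Proof.
move=> hx; rewrite Qint_def.
have [d1|d1] := leqP `|denq x|%N 1.
  have := denq_gt0 x; move: d1; case: (denq x) => // -[|[|]] //.
have [m pm /intrP[z xz]] := hx _ (pdiv_prime d1).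
have : (denq x %| m%:Z)%Z.
  rewrite -(@Gauss_dvdzr _ (numq x)); last first.
    by rewrite coprimezE coprime_sym coprime_num_den.
  apply/dvdzP; exists z; apply: (@intr_inj rat).
  rewrite !rmorphM /= -xz -[in X in _ = X * _ * _](divq_num_den x).
  by rewrite -pmulrn; field; rewrite intr_eq0 denq_neq0.
rewrite dvdzE /= => /(dvdn_trans (pdiv_dvd _)).
by move: pm; rewrite prime_coprime ?pdiv_prime // => /negP.
Qed.

(** * The fractional part at a prime: the representative of [x] in [0, 1) modulo the localization at
    [p] *)

Definition is_ppart p x : set rat :=
  [set y | [/\ prime p, ppower_denom p y, 0 <= y < 1 & pintegral p (x - y)]].

(** The difference of two candidates is an integer lying strictly between -1 and 1. *)
Lemma is_ppart_inj p x : is_subset1 (is_ppart p x).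
Proof.
move=> y z [pp yp /andP[y0 y1] xy] [_ zp /andP[z0 z1] xz].
have: y - z \is a Num.int.
  apply: (pintegral_ppower_int _ _ pp); last exact: ppower_denomB.
  by have := pintegralB _ _ _ xz xy; congr pintegral; ring.
move=> yz; have zy : z - y \is a Num.int by rewrite -opprB rpredN.
have zy0 : 0 <= z - y by apply: int_gtN1_ge0 => //; lra.
have yz0 : 0 <= y - z by apply: int_gtN1_ge0 => //; lra.
lra.
Qed.

(** With numerator [a], denominator [m * p ^ k] and [u * m + v * p ^ k = 1], one has x = a u / p^k +
    a v / m; the first term is then reduced modulo 1. *)
Lemma is_ppart_exists p x : prime p -> exists y, is_ppart p x y.
Proof.
move=> pp; set d := `|denq x|%N.
have d0 : (0 < d)%N by rewrite absz_gt0 denq_neq0.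
have dE : denq x = d%:Z by rewrite /d absz_denq.
have [m pm dm] := pfactor_coprime pp d0; set k := logn p d in dm.
have /coprimezP[[u v] /= uv] : coprimez m%:Z (p ^ k)%N%:Z.
  by rewrite coprimezE /= coprime_sym coprimeXl.
have pk0 : (0 < p ^ k)%N by rewrite expn_gt0 prime_gt0.
have pk0R : (0 : rat) < p%:R ^+ k by rewrite exprn_gt0 // ltr0n prime_gt0.
have m0 : (m%:R : rat) != 0.
  by rewrite pnatr_eq0; apply: contraTneq d0 => m0; rewrite dm m0.
pose c := ((numq x * u) %% (p ^ k)%N%:Z)%Z.
have c0 : 0 <= c by rewrite modz_ge0 // -lt0n.
have c1 : c < (p ^ k)%N by rewrite ltz_pmod.
exists (c%:~R / p%:R ^+ k); split=> //.
- by exists k; rewrite divfK ?lt0r_neq0 // intr_int.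
- rewrite divr_ge0 ?ler0z ?(ltW pk0R) //= ltr_pdivrMr // mul1r -natrX.
  by rewrite pmulrn ltr_int.
- exists m => //.
  (* The second summand is the quotient discarded in reducing [numq x * u] modulo [p ^ k]. *)
  have -> : (x - c%:~R / p%:R ^+ k) * m%:R =
     (numq x * v + (numq x * u %/ (p ^ k)%N%:Z)%Z * m)%:~R; last exact: intr_int.
  have xE : x = (numq x)%:~R / (m%:R * p%:R ^+ k).
    by rewrite -[LHS]divq_num_den dE -pmulrn dm natrM natrX.
  have cE : c%:~R = (numq x)%:~R * u%:~R
      - ((numq x * u) %/ (p ^ k)%N%:Z)%Z%:~R * p%:R ^+ k :> rat.
    by rewrite /c /modz rmorphB !rmorphM /= -pmulrn natrX.
  have vE : v%:~R * p%:R ^+ k = 1 - u%:~R * m%:R :> rat.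
    have := congr1 (intr : int -> rat) uv.
    by rewrite rmorphD !rmorphM /= -!pmulrn natrX => /(canRL (addKr _)) ->; rewrite addrC.
  rewrite [in LHS]xE cE rmorphD !rmorphM /= -pmulrn.
  have -> : v%:~R = (1 - u%:~R * m%:R) / p%:R ^+ k :> rat.
    by rewrite -vE mulfK // lt0r_neq0.
  by field; rewrite m0 lt0r_neq0.
Qed.

(* For [p] not prime this is [0], the default value of [xget]. *)
Definition ppart (p : nat) (x : rat) : rat := xget 0 (is_ppart p x).

Lemma ppartP p x : prime p -> is_ppart p x (ppart p x).
Proof. by move=> pp; have [y hy] := is_ppart_exists p x pp; apply: xgetI hy. Qed.

Lemma ppart_nonprime p x : ~~ prime p -> ppart p x = 0.
Proof.
by move=> /negP np; rewrite /ppart; case: xgetP => // y _ [].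
Qed.

Lemma ppart_unique p x y : is_ppart p x y -> ppart p x = y.
Proof.
move=> hy; have [pp _ _ _] := hy.
exact: (is_ppart_inj p x _ _ (ppartP p x pp)).
Qed.

Lemma ppart_ge0 p x : 0 <= ppart p x.
Proof.
have [/(ppartP p x)[_ _ /andP[]//]|/ppart_nonprime->//] := boolP (prime p).
Qed.

Lemma ppart_pintegral p x : pintegral p x -> ppart p x = 0.
Proof.
move=> hx; have [pp|/ppart_nonprime->//] := boolP (prime p).
apply: ppart_unique; split; rewrite ?subr0 //.
exact: ppower_denom_int.
Qed.

(** The difference of the two sides is an integer, and it exceeds -1 because
    [ppart p (x + y) < 1]. *)
Lemma ppart_le_add p x y : ppart p (x + y) <= ppart p x + ppart p y.
Proof.
have [pp|np] := boolP (prime p); last by rewrite !ppart_nonprime ?addr0.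
have [_ xd /andP[x0 x1] xi] := ppartP p x pp.
have [_ yd /andP[y0 y1] yi] := ppartP p y pp.
have [_ zd /andP[z0 z1] zi] := ppartP p (x + y) pp.
rewrite -subr_ge0; apply: int_gtN1_ge0; last by lra.
apply: (pintegral_ppower_int _ _ pp).
  have := pintegralB _ _ _ zi (pintegralD _ _ _ xi yi).
  by congr pintegral; ring.
by apply: ppower_denomB => //; apply: ppower_denomD.
Qed.

Lemma ppartB p x y :
  ppart p y <= ppart p x -> ppart p (x - y) = ppart p x - ppart p y.
Proof.
move=> yx; have [pp|np] := boolP (prime p); last first.
  by rewrite !ppart_nonprime ?subr0.
have [_ xd /andP[x0 x1] xi] := ppartP p x pp.
have [_ yd /andP[y0 y1] yi] := ppartP p y pp.
apply: ppart_unique; split=> //; first exact: ppower_denomB.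
  by apply/andP; split; lra.
by have := pintegralB _ _ _ xi yi; congr pintegral; ring.
Qed.

(** Fractional parts at finitely many primes can be prescribed independently: the terms at primes
    other than [q] are [q]-integral. *)
Lemma ppart_sum_ppower (f : nat -> rat) N q :
  (forall p, prime p -> ppower_denom p (f p) /\ 0 <= f p < 1) ->
  (forall p, ~~ prime p -> f p = 0) -> (forall p, (N <= p)%N -> f p = 0) ->
  ppart q (\sum_(0 <= p < N) f p) = f q.
Proof.
move=> fpp fnp fN; have [pq|nq] := boolP (prime q); last first.
  by rewrite ppart_nonprime ?fnp.
have [fq1 fq2] := fpp q pq.
apply: ppart_unique; split=> //.
have hsum (Q : pred nat) : (forall p, Q p -> p != q) ->
    pintegral q (\sum_(0 <= p < N | Q p) f p).
  move=> hQ; apply: pintegral_sum => p /hQ pq'.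
  have [pp|np] := boolP (prime p); last by rewrite fnp //; exact: pintegral_int.
  apply: (ppower_denom_pintegral _ _ _ pp pq); first by rewrite eq_sym.
  exact: (fpp p pp).1.
have [qN|qN] := ltnP q N.
  rewrite (bigD1_seq q) ?mem_index_iota ?iota_uniq //= [f q + _]addrC addrK.
  exact: hsum.
(* Here [q] is beyond the cutoff, so every term of the sum is [q]-integral and [f q] is 0. *)
rewrite fN // subr0 big_nat_cond; apply: hsum => p.
by rewrite andbT => /andP[_ pN]; rewrite neq_ltn (leq_trans pN).
Qed.

(** The denominator is itself a multiplier coprime to [p]. Hence only finitely many fractional parts
    of [x] are nonzero. *)
Lemma ppart_gt_denq p x : (`|denq x| < p)%N -> ppart p x = 0.
Proof.
move=> dp; have [pp|/ppart_nonprime->//] := boolP (prime p).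
apply: ppart_pintegral; exists `|denq x|%N.
  rewrite prime_coprime //; apply: contraL dp => /dvdn_leq.
  by rewrite -leqNgt absz_gt0 denq_neq0; apply.
have -> : x * `|denq x|%:R = (numq x)%:~R; last exact: intr_int.
by rewrite numqE natr_absz normr_denq.
Qed.

(** * The integer part left by partial fractions, and its behaviour under addition *)

Definition ipart (x : rat) : rat :=
  x - \sum_(0 <= p < `|denq x|.+1) ppart p x.

(** Freedom in the cutoff lets several rationals share one range of summation. *)
Lemma ipartE N x :
  (forall p, (N <= p)%N -> ppart p x = 0) ->
  ipart x = x - \sum_(0 <= p < N) ppart p x.
Proof.
move=> hN; congr (_ - _).
have extend A B : (A <= B)%N -> (forall p, (A <= p)%N -> ppart p x = 0) ->
    \sum_(0 <= p < A) ppart p x = \sum_(0 <= p < B) ppart p x.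
  move=> AB hA; rewrite (big_cat_nat _ AB) //=.
  rewrite [X in _ = _ + X]big_nat [X in _ = _ + X]big1 ?addr0 //.
  by move=> p /andP[Ap _]; exact: hA.
have [NB|/ltnW BN] := leqP N `|denq x|.+1; first by rewrite (extend _ _ NB hN).
by apply: extend => // p; exact: ppart_gt_denq.
Qed.

(** At each prime [q], [x] and the sum of its fractional parts agree modulo the localization, so
    their difference is integral everywhere. *)
Lemma ipart_int x : ipart x \is a Num.int.
Proof.
apply: pintegral_all_int => q pq.
pose N := `|denq x|.+1.
have [_ _ _ xi] := ppartP q x pq.
have hf p : prime p -> ppower_denom p (ppart p x) /\ 0 <= ppart p x < 1.
  by move=> pp; have [] := ppartP p x pp.
have := ppart_sum_ppower (fun p => ppart p x) N q hf.
move=> /(_ (fun p np => ppart_nonprime p x np)).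
move=> /(_ (fun p hp => ppart_gt_denq p x hp)) sE.
have [_ _ _] := ppartP q (\sum_(0 <= p < N) ppart p x) pq.
rewrite sE => si; have := pintegralB _ _ _ xi si.
by congr pintegral; rewrite /ipart /N; ring.
Qed.

(** The summand is the carry at [p] in the addition of fractional parts; [N] lies beyond all three
    denominators, so no carry is missed. *)
Lemma ipartD_ppart x y : exists N,
  ipart (x + y) = ipart x + ipart y +
    \sum_(0 <= p < N) (ppart p x + ppart p y - ppart p (x + y))
  /\ forall p, (N <= p)%N -> ppart p x + ppart p y - ppart p (x + y) = 0.
Proof.
exists (maxn `|denq x| (maxn `|denq y| `|denq (x + y)|)).+1.
set N := _.+1.
have hx p : (N <= p)%N -> ppart p x = 0.
  by rewrite /N !gtn_max => /andP[? _]; apply: ppart_gt_denq.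
have hy p : (N <= p)%N -> ppart p y = 0.
  by rewrite /N !gtn_max => /and3P[_ ? _]; apply: ppart_gt_denq.
have hz p : (N <= p)%N -> ppart p (x + y) = 0.
  by rewrite /N !gtn_max => /and3P[_ _ ?]; apply: ppart_gt_denq.
split; last by move=> p Np; rewrite hx ?hy ?hz // addr0 subr0.
rewrite (ipartE _ _ hx) (ipartE _ _ hy) (ipartE _ _ hz) sumrB big_split /=.
ring.
Qed.

Lemma ipart_superadd x y : ipart x + ipart y <= ipart (x + y).
Proof.
have [N [-> _]] := ipartD_ppart x y.
by rewrite lerDl sumr_ge0 // => p _; rewrite subr_ge0 ppart_le_add.
Qed.

(** The carries are nonnegative and sum to 0, so each of them vanishes. *)
Lemma ipartD_eq_ppartD x y : ipart (x + y) = ipart x + ipart y ->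
  forall p, ppart p (x + y) = ppart p x + ppart p y.
Proof.
have [N [-> hN]] := ipartD_ppart x y.
move=> /(canRL (addKr _)); rewrite addNr => /eqP.
rewrite psumr_eq0; last by move=> p _; rewrite subr_ge0 ppart_le_add.
move=> /allP h p; apply/esym/eqP; rewrite -subr_eq0.
have [pN|Np] := ltnP p N; last by rewrite hN.
by have := h p; rewrite mem_index_iota; apply.
Qed.

(** Under this domination, adding [y] back to [x - y] produces no carry. *)
Lemma ipartB x y : (forall p, ppart p y <= ppart p x) ->
  ipart (x - y) = ipart x - ipart y.
Proof.
move=> yx; have [N [+ _]] := ipartD_ppart (x - y) y.
rewrite subrK big1 ?addr0 => [->|p _]; first by rewrite addrK.
by rewrite (ppartB _ _ _ (yx p)) subrK subrr.
Qed.

Lemma ipart_ppart_eq0 x : ipart x = 0 -> (forall p, ppart p x = 0) -> x = 0.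
Proof. by move=> + h; rewrite /ipart big1 ?subr0. Qed.

(** Only the fractional part at [p] survives, so [ipart x] is the integer [x - ppart p x], which is
    greater than -1. *)
Lemma ipart_ppower_ge0 p x :
  prime p -> ppower_denom p x -> 0 <= x -> 0 <= ipart x.
Proof.
move=> pp xp x0; have [_ _ /andP[_ x1] _] := ppartP p x pp.
apply: int_gtN1_ge0; first exact: ipart_int.
suff -> : ipart x = x - ppart p x by lra.
rewrite (ipartE (maxn `|denq x| p).+1); last first.
  by move=> q; rewrite gtn_max => /andP[? _]; apply: ppart_gt_denq.
rewrite (bigD1_seq p) ?mem_index_iota ?iota_uniq ?ltnS ?leq_maxr //=.
rewrite big1 ?addr0 // => q qp.
have [pq|/ppart_nonprime->//] := boolP (prime q).
exact/ppart_pintegral/(ppower_denom_pintegral p).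
Qed.

(** * Membership in [MP P] read off from fractional and integer parts *)

Section MP.
Variables (P : set nat) (P_prime : P `<=` [set p | prime p]).
Hypothesis (P_neq0 : P !=set0).

(* Equivalently, the denominator of [x] involves only primes of [P]. *)
Definition integral_outside (x : rat) : Prop :=
  forall p, prime p -> ~ P p -> pintegral p x.

Lemma integral_outsideD x y :
  integral_outside x -> integral_outside y -> integral_outside (x + y).
Proof. by move=> hx hy p pp Pp; apply: pintegralD; [exact: hx|exact: hy]. Qed.

Lemma integral_outsideB x y :
  integral_outside x -> integral_outside y -> integral_outside (x - y).
Proof. by move=> hx hy p pp Pp; apply: pintegralB; [exact: hx|exact: hy]. Qed.

Lemma MP0 : MP P 0.
Proof. by exists [::]; rewrite ?big_nil. Qed.

Lemma MPD x y : MP P x -> MP P y -> MP P (x + y).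
Proof.
move=> [s sP ->] [t tP ->]; exists (s ++ t); last by rewrite big_cat.
by move=> z; rewrite mem_cat => /orP[/sP|/tP].
Qed.

Lemma ppower_MP p x : P p -> ppower_denom p x -> 0 <= x -> MP P x.
Proof.
move=> Pp [k xk] x0; have pp := P_prime _ Pp.
have pk0 : (0 : rat) < p%:R ^+ k by rewrite exprn_gt0 // ltr0n prime_gt0.
exists [:: x]; last by rewrite big_seq1.
move=> y; rewrite inE => /eqP ->; exists p => //.
have /natrP[a xa] : x * p%:R ^+ k \is a Num.nat.
  by rewrite natrEint xk mulr_ge0 // ltW.
by exists a, k; rewrite -xa mulfK // lt0r_neq0.
Qed.

(** Forward, the conditions hold for the generators and are stable under sums. Backward, partial
    fractions split [x] into elements of the generating monoids. *)
Lemma MPP x : MP P x <-> integral_outside x /\ 0 <= ipart x.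
Proof.
split=> [[s sP ->]|[xP x0]].
  have: forall y, y \in s -> integral_outside y /\ 0 <= ipart y.
    move=> y /sP[p Pp [a [n yE]]]; have pp := P_prime _ Pp.
    have yp : ppower_denom p y.
      exists n; rewrite yE divfK ?natr_int //.
      by rewrite expf_neq0 // pnatr_eq0 -lt0n prime_gt0.
    split.
      move=> q pq Pq; apply: (ppower_denom_pintegral p) => //.
      by apply/eqP => qp; rewrite qp in Pq.
    by apply: (ipart_ppower_ge0 p) => //; rewrite yE divr_ge0 // exprn_ge0.
  move=> hs; rewrite big_seq.
  apply: (big_ind (fun y => integral_outside y /\ 0 <= ipart y)) => //.
    split=> [p _ _|]; first exact: pintegral_int.
    have [p /P_prime pp] := P_neq0.
    by apply: (ipart_ppower_ge0 p) => //; exact: ppower_denom_int.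
  move=> y z [y1 y2] [z1 z2]; split; first exact: integral_outsideD.
  by apply: le_trans (ipart_superadd _ _); rewrite addr_ge0.
rewrite -[x](subrK (\sum_(0 <= p < `|denq x|.+1) ppart p x)); apply: MPD.
  (* The nonnegative integer [ipart x] belongs to the generating monoid of any [p] in [P]. *)
  have [p Pp] := P_neq0; apply: (ppower_MP p) => //.
  exact/ppower_denom_int/ipart_int.
apply: (big_ind (MP P)) => [||p _]; [exact: MP0|exact: MPD|].
have [pp|/ppart_nonprime->] := boolP (prime p); last exact: MP0.
have [Pp|/(xP _ pp)/ppart_pintegral->] := pselect (P p); last exact: MP0.
apply: (ppower_MP p) (ppart_ge0 _ _) => //.
by have [] := ppartP p x pp.
Qed.

Lemma MP_submonoid : additive_submonoid (MP P).
Proof.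
split; [|exact: MP0|exact: MPD].
move=> x /= [s sP ->]; rewrite big_seq sumr_ge0 // => y /sP[p _ [a [n ->]]].
by rewrite divr_ge0 // exprn_ge0.
Qed.

(** * Common divisors and the construction of an MCD *)

Lemma MP_subset_common_divisors (S : set rat) d : S `<=` MP P ->
  common_divisors (MP P) S d <-> MP P d /\ forall s, S s -> MP P (s - d).
Proof.
move=> SM; split=> [[Md h]|[Md h]]; split=> // s Ss; first by case: (h s Ss).
by split; [|exact: SM|exact: h].
Qed.

(** Membership in [MP P] makes each [ipart (x - d)] a natural number, so well-ordering gives a least
    sum. *)
Lemma common_divisors_minimize (s : seq rat) :
  {in s, forall x, MP P x} ->
  exists2 d, common_divisors (MP P) [set` s] d &
    forall e, common_divisors (MP P) [set` s] e ->
      \sum_(x <- s) ipart (x - d) <= \sum_(x <- s) ipart (x - e).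
Proof.
move=> sM; pose D := common_divisors (MP P) [set` s].
have DE d : D d <-> MP P d /\ forall x, x \in s -> MP P (x - d).
  exact: MP_subset_common_divisors.
have natD d : D d -> exists n : nat, \sum_(x <- s) ipart (x - d) = n%:R.
  move=> /DE[_ hd]; apply/natrP; rewrite natrEint rpred_sum /=; last first.
    by move=> x _; exact: ipart_int.
  by rewrite big_seq sumr_ge0 // => x /hd /MPP[].
pose V n := `[< exists2 d, D d & \sum_(x <- s) ipart (x - d) = n%:R >].
have exV : exists n, V n.
  have D0 : D 0 by apply/DE; split=> [|x xs]; [exact: MP0|rewrite subr0; exact: sM].
  by have [n hn] := natD _ D0; exists n; apply/asboolP; exists 0.
case: (ex_minnP exV) => n /asboolP[d Dd dn] nmin; exists d => // e De.
have [m em] := natD _ De.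
by rewrite dn em ler_nat; apply: nmin; apply/asboolP; exists e.
Qed.

Lemma seq_inhabited (s : seq rat) : s != [::] -> exists x, x \in s.
Proof. by case: s => // a s _; exists a; rewrite mem_head. Qed.

Lemma seq_argmin (s : seq rat) (f : rat -> rat) : s != [::] ->
  exists2 x, x \in s & {in s, forall y, f x <= f y}.
Proof.
elim: s => // a s IH _; have [->|/IH[x xs xmin]] := eqVneq s [::].
  by exists a; rewrite ?mem_head // => y; rewrite inE => /eqP->.
have [ax|xa] := leP (f a) (f x).
  exists a; first by rewrite mem_head.
  by move=> y; rewrite inE => /predU1P[->//|/xmin]; apply: le_trans.
exists x; first by rewrite inE xs orbT.
by move=> y; rewrite inE => /predU1P[->|/xmin//]; apply: ltW.
Qed.

(** [m] is the sum over primes of the smallest fractional parts occurring in [s]; being such a sum,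
    it has no integer part. *)
Lemma min_pparts (s : seq rat) : s != [::] ->
  exists2 m, ipart m = 0 &
    forall p, exists2 x, x \in s &
      ppart p m = ppart p x /\ {in s, forall y, ppart p m <= ppart p y}.
Proof.
move=> s0.
have /choice[sg sgP] : forall p, exists x,
    x \in s /\ {in s, forall y, ppart p x <= ppart p y}.
  by move=> p; have [x] := seq_argmin s (ppart p) s0; exists x.
have [x0 x0s] := seq_inhabited s s0.
(* Beyond the denominator of one entry [x0], that entry already has fractional part 0, hence so has
   the minimizer. *)
pose N := `|denq x0|.+1.
pose m := \sum_(0 <= p < N) ppart p (sg p).
have f0 p : (N <= p)%N -> ppart p (sg p) = 0.
  move=> Np; apply/eqP; rewrite eq_le ppart_ge0 andbT.
  by rewrite -(ppart_gt_denq p x0 Np); apply: (sgP p).2.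
have mE p : ppart p m = ppart p (sg p).
  apply: (ppart_sum_ppower (fun p => ppart p (sg p))) => // q.
    by move=> pq; have [] := ppartP q (sg q) pq.
  exact: ppart_nonprime.
exists m => [|p]; last by have [] := sgP p; exists (sg p); rewrite ?mE.
rewrite (ipartE N) => [|p Np]; last by rewrite mE f0.
by under eq_bigr do rewrite mE; rewrite subrr.
Qed.

Lemma MP_of_ppart_le m y : ipart m = 0 -> (forall p, ppart p m <= ppart p y) ->
  MP P y -> MP P m.
Proof.
move=> m0 my /MPP[yP _]; apply/MPP; split; last by rewrite m0.
move=> p pp Pp; have [_ _ _] := ppartP p m pp.
suff -> : ppart p m = 0 by rewrite subr0.
apply/eqP; rewrite eq_le ppart_ge0 andbT.
by rewrite -(ppart_pintegral p y (yP p pp Pp)).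
Qed.

Lemma MP_MCD_seq (s : seq rat) : s != [::] -> {in s, forall x, MP P x} ->
  exists d, is_MCD (MP P) [set` s] d.
Proof.
move=> s0 sM; have [d Dd dmin] := common_divisors_minimize s sM.
have DE := MP_subset_common_divisors _ _ sM.
have [Md sd] := (DE _).1 Dd.
have [|m m0 mP] := min_pparts [seq x - d | x <- s].
  by rewrite -size_eq0 size_map size_eq0.
have m_le x p : x \in s -> ppart p m <= ppart p (x - d).
  by move=> xs; have [_ _ [_]] := mP p; apply; apply: map_f.
have ipE x : x \in s -> ipart (x - (d + m)) = ipart (x - d).
  by move=> xs; rewrite opprD addrA (ipartB (x - d)) ?m0 ?subr0 // => p; exact: m_le.
have [x0 x0s] := seq_inhabited s s0.
have Mm : MP P m.
  by apply: (MP_of_ppart_le _ (x0 - d)) (sd _ x0s) => // p; exact: m_le.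
have sdm x : x \in s -> MP P (x - (d + m)).
  move=> xs; apply/MPP; rewrite ipE //; split; last by case/MPP: (sd _ xs).
  rewrite opprD addrA; apply: integral_outsideB; last by case/MPP: Mm.
  by case/MPP: (sd _ xs).
exists (d + m); split; first by apply/DE; split; [exact: MPD|].
have imM : [set x - (d + m) | x in [set` s]] `<=` MP P.
  by move=> _ [x xs <-]; exact: sdm.
apply/seteqP; split=> [e /(MP_subset_common_divisors _ _ imM)[Me se]|_ ->];
  last first.
  apply/(MP_subset_common_divisors _ _ imM); split; first exact: MP0.
  by move=> x /imM; rewrite subr0.
have {}se x : x \in s -> MP P (x - (d + m) - e).
  by move=> xs; apply: se; exists x.
have /MPP[_ e0] := Me.
have sup x : ipart (x - (d + m) - e) + ipart e <= ipart (x - (d + m)).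
  by have := ipart_superadd (x - (d + m) - e) e; rewrite subrK.
(* [d + m + e] competes with [d] in the minimization, so subtracting [e] cannot lower any integer
   part. *)
have Ddme : common_divisors (MP P) [set` s] (d + m + e).
  apply/DE; split=> [|x xs]; last by rewrite opprD addrA; exact: se.
  by apply: MPD => //; exact: MPD.
have no_drop x : x \in s -> ipart (x - (d + m) - e) = ipart (x - (d + m)).
  move=> xs; apply/eqP; rewrite eq_le; apply/andP; split.
    by have := sup x; lra.
  rewrite leNgt; apply/negP => lt_x.
  have := dmin _ Ddme; rewrite leNgt => /negP; apply.
  (* A strict drop at [x], with no increase at the other entries, would contradict the minimality of
     [d]. *)
  rewrite !(big_rem x xs) /= ltr_leD //.
    by rewrite opprD addrA -(ipE _ xs).
  rewrite big_seq [leRHS]big_seq; apply: ler_sum => y /mem_rem ys.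
  by rewrite opprD addrA -(ipE _ ys); have := sup y; lra.
apply: ipart_ppart_eq0 => [|p].
  by have := sup x0; rewrite (no_drop _ x0s); lra.
(* This [x] attains the minimum at [p], so nothing is left at [p] in [x - (d + m)]. Without carries,
   the parts of [e] and of the remainder add up to 0. *)
have [_ /mapP[x xs ->] [mpx _]] := mP p.
have xdm0 : ppart p (x - (d + m)) = 0.
  by rewrite opprD addrA (ppartB _ (x - d)) mpx ?subrr.
have ie0 : ipart e = 0 by have := sup x; rewrite no_drop //; lra.
have := ipartD_eq_ppartD (x - (d + m) - e) e.
rewrite subrK no_drop // ie0 addr0 => /(_ erefl p); rewrite xdm0.
by have := ppart_ge0 p e; have := ppart_ge0 p (x - (d + m) - e); lra.
Qed.

End MP.

Theorem theorem3p7 (P : set nat) (P_prime : P `<=` [set p | prime p])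
    (P_neq0 : P !=set0) : MCD_monoid (MP P).
Proof.
split; first exact: MP_submonoid.
move=> S SM /finite_seqP[s sE] [x Sx]; rewrite sE in SM Sx *.
apply: MP_MCD_seq => //.
by apply/eqP => s0; rewrite s0 in Sx.
Qed.
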